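(* Let $V\subseteq\mathcal V$ be finite, $\mathcal E\in\mathit{DProg}(V)$, $W\subseteq\mathcal V$ finite, $P,Q$ projectors on $\mathcal H_W$, and $xp^p\in\{wp^p,wlp^p\}$. Then: (1) $wp^p.\mathcal E.0=sp^p.\mathcal E.0=0$ and $wlp^p.\mathcal E.I_W=I_W$; (2) if $P\sqsubseteq Q$ then $xp^p.\mathcal E.P\sqsubseteq xp^p.\mathcal E.Q$ and $sp^p.\mathcal E.P\sqsubseteq sp^p.\mathcal E.Q$; (3) $xp^p.\mathcal E.(P\wedge Q)=xp^p.\mathcal E.P\wedge xp^p.\mathcal E.Q$; (4) $sp^p.\mathcal E.(P\wedge Q)\sqsubseteq sp^p.\mathcal E.P\wedge sp^p.\mathcal E.Q$; (5) $xp^p.\mathcal E.P\vee xp^p.\mathcal E.Q\sqsubseteq xp^p.\mathcal E.(P\vee Q)$; (6) $sp^p.\mathcal E.P\vee sp^p.\mathcal E.Q=sp^p.\mathcal E.(P\vee Q)$; (7) if $R$ is a projector on $\mathcal H_{W'}$ with $W'$ finite and $W'\cap(V\cup W)=\emptyset$, then $wp^p.\mathcal E.(Q\otimes R)=(wp^p.\mathcal E.Q)\otimes R$, $sp^p.\mathcal E.(P\otimes R)=(sp^p.\mathcal E.P)\otimes R$, and $wlp^p.\mathcal E.(Q\otimes R)\sqsupseteq(wlp^p.\mathcal E.Q)\otimes R$.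
   Context: $\mathcal V$ is a countably infinite set of qubit variables; $\mathcal H_V=\bigotimes_{q\in V}\mathcal H_q$ with identity $I_V$. $\mathcal D(\mathcal H)$: partial density operators; projectors are identified with their image subspaces, ordered by inclusion $\sqsubseteq$; $\wedge$ is intersection and $\vee$ the span of the union. $\mathit{DProg}(V)$: completely positive trace-nonincreasing super-operators on $\mathcal L(\mathcal H_V)$. Convention: operators and super-operators on subsystems are implicitly extended to larger systems by tensoring with identities; the transformers of a projector on a system $U$ are regarded as projectors on $\mathcal H_{V\cup U}$. For projectors $P,Q$ on $\mathcal H_U$: $\mathcal E\models_{tot}(P,Q)$ iff for all finite $X\supseteq V\cup U$ and $\rho\in\mathcal D(\mathcal H_X)$, ${\rm tr}(P\rho)\le{\rm tr}(Q\mathcal E(\rho))$; $\mathcal E\models_{par}(P,Q)$ iff for all such $X,\rho$, ${\rm tr}(P\rho)\le{\rm tr}(Q\mathcal E(\rho))+{\rm tr}(\rho)-{\rm tr}(\mathcal E(\rho))$. $wp^p.\mathcal E.Q$ is the largest projector $P$ with $\mathcal E\models_{tot}(P,Q)$; $wlp^p.\mathcal E.Q$ the largest projector $P$ with $\mathcal E\models_{par}(P,Q)$; $sp^p.\mathcal E.Q$ the smallest projector $R$ with $\mathcal E\models_{par}(Q,R)$. *)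

(* Defs.v *)
(* MathComp (+ finmap, real-closed's complex numbers over Stdlib's R). *)
From HB Require Import structures.
From mathcomp Require Import all_boot all_order all_algebra.
From mathcomp Require Import finmap.
From mathcomp Require Import Rstruct complex.
From mathcomp Require Import spectral.
From Stdlib Require Import ClassicalEpsilon.

Set Implicit Arguments.
Unset Strict Implicit.
Unset Printing Implicit Defensive.

Import Order.TTheory GRing.Theory Num.Theory.
Local Open Scope ring_scope.
Local Open Scope fset_scope.
Local Open Scope sesquilinear_scope.

(** Scalars: the complex numbers, built over Stdlib's real numbers. *)
Definition C : numClosedFieldType := (Rdefinitions.R)[i].

(** Qubit variables are natural numbers (a countably infinite set).
    A finite set of variables is an [X : {fset nat}].  The computational
    basis of H_X = (C^2)^{tensor X} is indexed by the assignments
    [X -> bool]; operators on H_X are square matrices over this basis. *)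
Definition basis (X : {fset nat}) := {ffun X -> bool}.
Definition dim (X : {fset nat}) := #|{: basis X}|.
Definition Op (X : {fset nat}) := 'M[C]_(dim X).

Definition bv {X : {fset nat}} (i : 'I_(dim X)) : basis X := enum_val i.
Definition bi {X : {fset nat}} (b : basis X) : 'I_(dim X) := enum_rank b.

(** value of an assignment at a variable (false outside its domain) *)
Definition aval {X : {fset nat}} (b : basis X) (n : nat) : bool :=
  if @insub _ (fun x => x \in X) X n is Some x then b x else false.

(** restriction of an assignment on X to the variables of Y *)
Definition restr {X : {fset nat}} (Y : {fset nat}) (b : basis X) : basis Y :=
  [ffun y : Y => aval b (val y)].

(** gluing an assignment on V and one on Z into one on X *)
Definition glue (X : {fset nat}) {V Z : {fset nat}} (a : basis V) (c : basis Z) : basis X :=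
  [ffun x : X => if val x \in V then aval a (val x) else aval c (val x)].

(** Cylindrical extension A (x) I_{Y \ X} of an operator on H_X to H_Y
    (meaningful when X is a subset of Y). *)
Definition ext {X : {fset nat}} (A : Op X) (Y : {fset nat}) : Op Y :=
  \matrix_(i, j) (A (bi (restr X (bv i))) (bi (restr X (bv j))) *
     (restr (Y `\` X) (bv i) == restr (Y `\` X) (bv j))%:R).

(** Tensor product A (x) B of operators on H_X and H_Y, as an operator on
    H_(X u Y) (meaningful when X and Y are disjoint). *)
Definition tens {X Y : {fset nat}} (A : Op X) (B : Op Y) : Op (X `|` Y) :=
  \matrix_(i, j) (A (bi (restr X (bv i))) (bi (restr X (bv j))) *
                  B (bi (restr Y (bv i))) (bi (restr Y (bv j)))).

(** Extension E (x) id_{X \ V} of a super-operator on L(H_V) to L(H_X)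
    (meaningful when V is a subset of X). *)
Definition extS {V : {fset nat}} (E : Op V -> Op V) {X : {fset nat}}
    (rho : Op X) : Op X :=
  \matrix_(i, j)
    (E (\matrix_(k, l)
          rho (bi (glue X (bv k) (restr (X `\` V) (bv i))))
              (bi (glue X (bv l) (restr (X `\` V) (bv j))))))
      (bi (restr V (bv i))) (bi (restr V (bv j))).

(** positive semidefinite operators *)
Definition psd {X : {fset nat}} (A : Op X) : Prop :=
  forall v : 'rV[C]_(dim X), 0 <= (v *m A *m v ^t*) 0 0.

(** partial density operators D(H_X) *)
Definition pdo {X : {fset nat}} (rho : Op X) : Prop := psd rho /\ \tr rho <= 1.

(** (orthogonal) projectors *)
Definition projector {X : {fset nat}} (P : Op X) : Prop :=
  P *m P = P /\ P ^t* = P.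

(** image (column space) of an operator, as a row-space matrix *)
Definition img {X : {fset nat}} (P : Op X) := (P^T)%R.

(** P [= Q : inclusion of image subspaces *)
Definition leproj {X : {fset nat}} (P Q : Op X) : Prop :=
  (img P <= img Q)%MS.

(** comparison / equality of operators on possibly different systems,
    both regarded (by cylindrical extension) as operators on X u Y *)
Definition leprojX {X Y : {fset nat}} (P : Op X) (Q : Op Y) : Prop :=
  leproj (ext P (X `|` Y)) (ext Q (X `|` Y)).
Definition eqopX {X Y : {fset nat}} (P : Op X) (Q : Op Y) : Prop :=
  ext P (X `|` Y) = ext Q (X `|` Y).

(** meet (intersection) and join (span of the union) of projectors:
    the projector onto the intersection / sum of the image subspaces *)
Definition pmeet {X : {fset nat}} (P Q : Op X) : Op X :=
  epsilon (inhabits 0)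
    (fun R => projector R /\ (img R == img P :&: img Q)%MS).
Definition pjoin {X : {fset nat}} (P Q : Op X) : Op X :=
  epsilon (inhabits 0)
    (fun R => projector R /\ (img R == img P + img Q)%MS).

(** DProg(V): completely positive, trace-nonincreasing super-operators *)
Definition DProg {V : {fset nat}} (E : {linear Op V -> Op V}) : Prop :=
  (forall X : {fset nat}, V `<=` X ->
     forall rho : Op X, psd rho -> psd (extS E rho)) /\
  (forall rho : Op V, psd rho -> \tr (E rho) <= \tr rho).

(** total and partial correctness |=tot (P, Q), |=par (P, Q) *)
Definition sat_tot {V : {fset nat}} (E : {linear Op V -> Op V})
    {U1 U2 : {fset nat}} (P : Op U1) (Q : Op U2) : Prop :=
  forall X : {fset nat}, V `|` U1 `|` U2 `<=` X ->
  forall rho : Op X, pdo rho ->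
    \tr (ext P X *m rho) <= \tr (ext Q X *m extS E rho).

Definition sat_par {V : {fset nat}} (E : {linear Op V -> Op V})
    {U1 U2 : {fset nat}} (P : Op U1) (Q : Op U2) : Prop :=
  forall X : {fset nat}, V `|` U1 `|` U2 `<=` X ->
  forall rho : Op X, pdo rho ->
    \tr (ext P X *m rho) <=
      \tr (ext Q X *m extS E rho) + \tr rho - \tr (extS E rho).

(** Predicate transformers.  For Q a projector on H_W, the transformers are
    projectors on H_(V u W).  They are defined as the largest (resp.
    smallest) projector with the required property (classical choice). *)
Definition wp {V : {fset nat}} (E : {linear Op V -> Op V})
    {W : {fset nat}} (Q : Op W) : Op (V `|` W) :=
  epsilon (inhabits 0) (fun P => projector P /\ sat_tot E P Q /\
    forall P' : Op (V `|` W), projector P' -> sat_tot E P' Q -> leproj P' P).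

Definition wlp {V : {fset nat}} (E : {linear Op V -> Op V})
    {W : {fset nat}} (Q : Op W) : Op (V `|` W) :=
  epsilon (inhabits 0) (fun P => projector P /\ sat_par E P Q /\
    forall P' : Op (V `|` W), projector P' -> sat_par E P' Q -> leproj P' P).

Definition sp {V : {fset nat}} (E : {linear Op V -> Op V})
    {W : {fset nat}} (Q : Op W) : Op (V `|` W) :=
  epsilon (inhabits 0) (fun R => projector R /\ sat_par E Q R /\
    forall R' : Op (V `|` W), projector R' -> sat_par E Q R' -> leproj R R').

(* Main.v *)
(* Write F for E extended to H_(V u W), D for its trace adjoint and Q~ for the
   extension of Q.  A projector P lies below an effect A (0 <= A <= 1) exactly
   when (1 - A) P = 0, and tr (A B) = 0 forces A B = 0 for positive A and B.
   Hence wp Q is the projector onto the kernel of 1 - D(Q~), wlp Q the one onto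
   the kernel of D(1 - Q~), and sp P the one onto the image of F(P~).  Kernels
   and images enter only through factorizations such as 1 - K = T B, which are
   preserved by tensoring with identities; so all clauses become identities
   between products of matrices. *)

Require Import Defs.
From HB Require Import structures.
From mathcomp Require Import all_boot all_order all_algebra.
From mathcomp Require Import finmap.
From mathcomp Require Import spectral.
From Stdlib Require Import ClassicalEpsilon.

Set Implicit Arguments.
Unset Strict Implicit.
Unset Printing Implicit Defensive.

Import Order.TTheory GRing.Theory Num.Theory.
Local Open Scope fset_scope.
Local Open Scope ring_scope.
Local Open Scope sesquilinear_scope.

(* Otherwise simplification exposes C as R[i], on which rewriting fails to
   recover the numClosedFieldType structure. *)
Local Opaque C.

(** * Adjoints, positive operators and projectors *)

(** Correctness quantifies over every finite system containing the variables, and has to be brought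
    down to one operator inequality on the smallest of them. The trace adjoint makes this possible:
    it commutes with cylindrical extension, and extension preserves positivity. For the same reason
    the trace bound, assumed on H_V alone, becomes 1 - D(1) >= 0 on every larger system, so that
    D(Q~) and 1 - D(1 - Q~) are effects. Preconditions and postconditions are linked by the fact
    that, for a projector P, D(1 - Q~) P = 0 and (1 - Q~) F(P) = 0 are both equivalent to tr ((1 -
    Q~) F(P)) = 0. Total correctness adds only that F preserves the trace of P, a condition that
    does not mention Q; wp and wlp can therefore share one proof of clauses (2), (3) and (5). *)

Section Adjoint.
Variable F : numClosedFieldType.

Lemma trmxCM m n p (A : 'M[F]_(m, n)) (B : 'M[F]_(n, p)) :
  (A *m B) ^t* = B ^t* *m A ^t*.
Proof. by rewrite trmx_mul map_mxM. Qed.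

Lemma trmxCD m n (A B : 'M[F]_(m, n)) : (A + B) ^t* = A ^t* + B ^t*.
Proof. by rewrite linearD map_mxD. Qed.

Lemma trmxCB m n (A B : 'M[F]_(m, n)) : (A - B) ^t* = A ^t* - B ^t*.
Proof. by rewrite linearB map_mxB. Qed.

Lemma trmxCZ m n (c : F) (A : 'M[F]_(m, n)) : (c *: A) ^t* = c^* *: A ^t*.
Proof. by rewrite linearZ map_mxZ. Qed.

Lemma trmxC1 n : (1%:M : 'M[F]_n) ^t* = 1%:M.
Proof. by rewrite trmx1 map_mx1. Qed.

Lemma trmxC0 m n : (0 : 'M[F]_(m, n)) ^t* = 0.
Proof. by rewrite trmx0 map_mx0. Qed.

Lemma trmxC00 (A : 'M[F]_1) : (A ^t*) 0 0 = (A 0 0)^*.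
Proof. by rewrite !mxE. Qed.

(** Polarization. Complex scalars matter: over the reals a skew-symmetric form would be a
    counterexample. *)
Lemma quad_form_eq0 n (H : 'M[F]_n) :
  (forall v : 'rV_n, (v *m H *m v ^t*) 0 0 = 0) -> H = 0.
Proof.
move=> H0.
have bil (v w : 'rV_n) : (v *m H *m w ^t*) 0 0 = 0.
  pose a := (v *m H *m w ^t*) 0 0; pose b := (w *m H *m v ^t*) 0 0.
  (* These are the cross terms of the form at [v + c *: w]. Taking [c = 1] gives [a = - b], and then
     [c = 'i] forces [b = 0]. *)
  have e c : c^* * a + c * b = 0.
    have := H0 (v + c *: w).
    rewrite trmxCD trmxCZ !mulmxDl !mulmxDr -!scalemxAl -!scalemxAr.
    have:= H0 v; have := H0 w; rewrite !mxE => -> ->.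
    by rewrite !mulr0 addr0 add0r /a /b !mxE.
  have := e 1; rewrite conjC1 !mul1r => /eqP; rewrite addr_eq0 => /eqP ab.
  have := e 'i; rewrite conjCi ab mulrNN => /eqP.
  rewrite -mulr2n mulrn_eq0 /= mulf_eq0 (negPf (neq0Ci _)) => /eqP b0.
  by rewrite -/a ab b0 oppr0.
apply/matrixP => i j; have := bil (delta_mx 0 i) (delta_mx 0 j).
by rewrite -rowE trmx_delta map_delta_mx -colE !mxE.
Qed.

Lemma tr_mul_trmxC m n (A : 'M[F]_(m, n)) :
  \tr (A *m A ^t*) = \sum_i \sum_j `|A i j| ^+ 2.
Proof.
by apply: eq_bigr => i _; rewrite mxE; apply: eq_bigr => j _;
  rewrite !mxE normCK.
Qed.

Lemma tr_mul_trmxC_ge0 m n (A : 'M[F]_(m, n)) : 0 <= \tr (A *m A ^t*).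
Proof.
by rewrite tr_mul_trmxC; do 2![apply: sumr_ge0 => ? _]; rewrite exprn_ge0.
Qed.

Lemma tr_mul_trmxC_eq0 m n (A : 'M[F]_(m, n)) :
  \tr (A *m A ^t*) = 0 -> A = 0.
Proof.
have ge0 i : true -> 0 <= \sum_j `|A i j| ^+ 2.
  by move=> _; apply: sumr_ge0 => j _; rewrite exprn_ge0.
rewrite tr_mul_trmxC => /(psumr_eq0P ge0) A0; apply/matrixP => i j.
have ge0' k : true -> 0 <= `|A i k| ^+ 2 by rewrite exprn_ge0.
have /eqP := psumr_eq0P ge0' (A0 i isT) (erefl : true) (i := j).
by rewrite expf_eq0 normr_eq0 /= mxE => /eqP.
Qed.

(** Nondegeneracy of the trace pairing, tested on matrix units. Identities for the trace adjoint are
    later proved by pairing both sides with an arbitrary operator. *)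
Lemma mxtrace_mul_inj n (A B : 'M[F]_n) :
  (forall M, \tr (A *m M) = \tr (B *m M)) -> A = B.
Proof.
move=> AB; apply/matrixP => i j; have := AB (delta_mx j i).
rewrite !(mxtrace_mulC _ (delta_mx _ _)) => h.
have e (M : 'M[F]_n) : \tr (delta_mx j i *m M) = M i j.
  rewrite /mxtrace (bigD1 j) //= big1 => [|k kj].
    rewrite addr0 mxE (bigD1 i) //= big1 => [|l li].
      by rewrite mxE !eqxx mul1r addr0.
    by rewrite mxE eqxx (negPf li) mul0r.
  by rewrite mxE big1 // => l _; rewrite mxE (negPf kj) mul0r.
by move: h; rewrite !e.
Qed.

End Adjoint.

(** * Positive semidefinite operators, and projectors below an effect *)

Section Psd.
Variable X : {fset nat}.
Implicit Types A B K P Q R S : Op X.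

(** In the order on [C], being nonnegative includes being real, so the quadratic forms of [A] and of
    its adjoint agree and polarization applies. *)
Lemma psd_herm A : psd A -> A ^t* = A.
Proof.
move=> psdA; apply/eqP; rewrite -subr_eq0; apply/eqP.
apply: quad_form_eq0 => v; rewrite mulmxBr mulmxBl.
have -> : v *m A ^t* *m v ^t* = (v *m A *m v ^t*) ^t*.
  by rewrite !trmxCM trmxCK mulmxA.
rewrite [LHS]mxE trmxC00 [in X in _ + X]mxE.
by rewrite (CrealP (ger0_real (psdA v))) subrr.
Qed.

Lemma psd_gram m (B : 'M[C]_(m, Defs.dim X)) : psd (B ^t* *m B).
Proof.
move=> v; have := tr_mul_trmxC_ge0 (v *m B ^t*).
by rewrite trace_mx11 trmxCM trmxCK !mulmxA.
Qed.

Lemma psd_sqrt A : psd A -> exists B, A = B ^t* *m B.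
Proof.
move=> psdA; have Aherm := psd_herm psdA.
have /orthomx_spectralP : A \is normalmx by apply/normalmxP; rewrite Aherm.
set U := spectralmx A; set d := spectral_diag A.
have Uu : U \is unitarymx by apply: spectral_unitarymx.
rewrite invmx_unitary // => AE.
(* Each eigenvalue is the value of the quadratic form at the corresponding row of [U]. *)
have d_ge0 i : 0 <= d 0 i.
  have := psdA (row i U); rewrite AE rowE !trmxCM !mulmxA.
  have /unitarymxP UU := Uu.
  rewrite -(mulmxA _ U) UU mulmx1 -(mulmxA _ U) UU mulmx1.
  rewrite -rowE row_diag_mx trmx_delta map_delta_mx -scalemxAl -rowE mxE.
  by rewrite !mxE !eqxx mulr1.
pose e := \row_i sqrtC (d 0 i).
exists (diag_mx e *m U); rewrite trmxCM !mulmxA -(mulmxA _ _ (diag_mx e)).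
rewrite AE; congr (_ *m _ *m _).
rewrite tr_diag_mx map_diag_mx mulmx_diag; congr diag_mx.
apply/rowP => i; rewrite !mxE /= geC0_conj ?sqrtC_ge0 //.
by rewrite -expr2 sqrtCK.
Qed.

Lemma psdD A B : psd A -> psd B -> psd (A + B).
Proof.
by move=> pA pB v; rewrite mulmxDr mulmxDl mxE addr_ge0.
Qed.

Lemma psd_tr_mul_ge0 A B : psd A -> psd B -> 0 <= \tr (A *m B).
Proof.
move=> /psd_sqrt[a ->] /psd_sqrt[b ->].
rewrite -mulmxA mxtrace_mulC mulmxA -mulmxA.
by have := tr_mul_trmxC_ge0 (a *m b ^t*); rewrite trmxCM trmxCK !mulmxA.
Qed.

Lemma psd_tr_mul_eq0 A B : psd A -> psd B -> \tr (A *m B) = 0 -> A *m B = 0.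
Proof.
move=> /psd_sqrt[a ->] /psd_sqrt[b ->].
rewrite -mulmxA mxtrace_mulC !mulmxA => ab0.
have /tr_mul_trmxC_eq0 h : \tr ((a *m b ^t*) *m (a *m b ^t*) ^t*) = 0.
  by rewrite trmxCM trmxCK !mulmxA.
by rewrite -[_ *m a *m b ^t*]mulmxA h mulmx0 mul0mx.
Qed.

(** Self-duality of the positive cone; rank-one operators v* v suffice as tests for the converse. *)
Lemma psd_trP A : psd A <-> (forall rho, psd rho -> 0 <= \tr (A *m rho)).
Proof.
split=> [pA rho /(psd_tr_mul_ge0 pA)//|h v].
have := h _ (psd_gram v); rewrite mulmxA mxtrace_mulC mulmxA.
by rewrite trace_mx11.
Qed.

Lemma projector_psd P : projector P -> psd P.
Proof. by case=> PP Ph; rewrite -PP -{1}Ph; apply: psd_gram. Qed.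

Lemma projector0 : projector (0 : Op X).
Proof. by split; rewrite ?mulmx0 ?trmxC0. Qed.

Lemma projector1 : projector (1%:M : Op X).
Proof. by split; rewrite ?mulmx1 ?trmxC1. Qed.

Lemma projectorC P : projector P -> projector (1%:M - P).
Proof.
case=> PP Ph; split; last by rewrite trmxCB Ph trmxC1.
by rewrite mulmxBl mul1mx mulmxBr mulmx1 PP subrr subr0.
Qed.

Lemma projector_mulC P Q : projector P -> projector Q -> P *m Q = Q *m P ->
  projector (P *m Q).
Proof.
move=> [PP Ph] [QQ Qh] PQ; split; last by rewrite trmxCM Ph Qh.
by rewrite {2}PQ !mulmxA -(mulmxA P) QQ PQ -!mulmxA PP.
Qed.

Lemma projector_mul_eq P Q : projector P -> projector Q ->
  P *m Q = Q -> Q *m P = Q.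
Proof.
by move=> [_ Ph] [_ Qh] PQ; rewrite -{1}Qh -Ph -trmxCM PQ.
Qed.

(** If P <= A, pairing A - P with P gives tr ((1 - A) P) <= 0, and a vanishing trace of positive
    operators kills the product. Conversely A P = P makes A commute with P, so A - P = (1 - P) A (1
    - P), which is positive. *)
Lemma psd_sub_projector_mul A P : psd A -> psd (1%:M - A) -> projector P ->
  psd (A - P) <-> A *m P = P.
Proof.
move=> pA p1A projP; have [PP Ph] := projP; split=> [pAP|AP].
  have pP := projector_psd projP.
  have h1 := psd_tr_mul_ge0 pAP pP.
  have h2 := psd_tr_mul_ge0 p1A pP.
  have /(psd_tr_mul_eq0 p1A pP) : \tr ((1%:M - A) *m P) = 0.
    apply/eqP; rewrite eq_le h2 andbT.
    move: h1; rewrite !mulmxBl mul1mx PP !linearB /=.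
    by rewrite subr_ge0 subr_le0.
  by rewrite mulmxBl mul1mx => /eqP; rewrite subr_eq0 => /eqP.
have PA : P *m A = P.
  by rewrite -{1}Ph -(psd_herm pA) -trmxCM AP.
have -> : A - P = (1%:M - P) ^t* *m A *m (1%:M - P).
  rewrite trmxCB Ph trmxC1 mulmxBl mul1mx PA mulmxBr mulmx1.
  by rewrite mulmxBl AP PP subrr subr0.
have [a ->] := psd_sqrt pA.
by have := psd_gram (a *m (1%:M - P)); rewrite trmxCM !mulmxA.
Qed.

Lemma leprojP P Q : projector Q -> leproj P Q <-> Q *m P = P.
Proof.
case=> QQ _; rewrite /leproj /img; split=> [/submxP[B]|<-].
  move/(congr1 trmx); rewrite trmx_mul !trmxK => ->.
  by rewrite mulmxA QQ.
by rewrite trmx_mul submxMl.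
Qed.

Lemma leproj_refl P : leproj P P.
Proof. exact: submx_refl. Qed.

Lemma leproj_anti P Q : projector P -> projector Q ->
  leproj P Q -> leproj Q P -> P = Q.
Proof.
move=> pP pQ /(leprojP _ pQ) QP /(leprojP _ pP) PQ.
by rewrite -QP (projector_mul_eq pP pQ PQ).
Qed.

(** [proj_ortho M] acts on row vectors, while [img] reads columns, so the witness is its transpose.
    It is Hermitian because the rows of 1 - p are orthogonal to those of p: this gives p* = p p*,
    whose right side is Hermitian. *)
Lemma exists_projector n (M : 'M[C]_(n, Defs.dim X)) :
  exists P, projector P /\ (img P == M)%MS.
Proof.
pose p := proj_ortho M; have pp : p *m p = p by apply: proj_ortho_proj.
have ph : p ^t* = p.
  have : (1%:M - 1%:M *m p) *m p ^t* = 0.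
    apply/orthomx1P.
    rewrite (submx_trans (proj_ortho_compl_sub _ _)) //.
    by rewrite (eqmx_ortho _ (proj_orthoE _)).
  rewrite mul1mx mulmxBl mul1mx => /eqP; rewrite subr_eq0 => /eqP e.
  have e' : p = p *m p ^t* by rewrite -{1}[p]trmxCK {1}e trmxCM trmxCK.
  by rewrite e -e'.
exists p^T; split; last by rewrite /img trmxK; apply/eqmxP/proj_orthoE.
split; first by rewrite -trmx_mul pp.
by rewrite -[in RHS]ph trmxK map_trmx trmxK.
Qed.

End Psd.

(** * Kernel and support projectors, meets and joins *)

Lemma sub_addsmx_trP (F : fieldType) n (A P Q : 'M[F]_n) :
  (A^T <= P^T + Q^T)%MS -> exists S T, A = P *m S + Q *m T.
Proof.
move=> /sub_addsmxP[[S T] /= AE]; exists S^T, T^T.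
by rewrite -[A]trmxK AE linearD /= !trmx_mul !trmxK.
Qed.

Section SupportKernel.
Variable X : {fset nat}.
Implicit Types A B K P Q R S T M : Op X.

(** The last two conditions are the two inclusions between the column space of [S] and the image of
    [P], written as matrix identities. *)
Definition supp_projector S P :=
  [/\ projector P, P *m S = S & exists B, P = S *m B].

(** The factor [T] encodes that the kernel of [B] lies in the image of [K]: from [B *m M = 0] it
    follows at once that [K *m M = M]. *)
Definition ker_projector B K :=
  [/\ projector K, B *m K = 0 & exists T, 1%:M - K = T *m B].

Lemma exists_supp_projector S : exists P, supp_projector S P.
Proof.
have [P [projP /andP[/submxP[B PE] /submxP[T SE]]]] := exists_projector S^T.
exists P; split=> //.
  have -> : S = P *m T^T by rewrite -[S]trmxK SE trmx_mul trmxK.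
  by rewrite mulmxA projP.1.
by exists B^T; rewrite -[P]trmxK [P^T]PE trmx_mul trmxK.
Qed.

(** The kernel of B is the orthogonal complement of the image of B*. *)
Lemma exists_ker_projector B : exists K, ker_projector B K.
Proof.
have [P [projP PB [T PE]]] := exists_supp_projector (B ^t*).
have Ph := projP.2.
exists (1%:M - P); split; first exact: projectorC.
  by rewrite mulmxBr mulmx1 -{2}[B]trmxCK -Ph -trmxCM PB trmxCK subrr.
by exists (T ^t*); rewrite subKr -Ph PE trmxCM trmxCK.
Qed.

Lemma ker_projectorP B K M : ker_projector B K -> B *m M = 0 <-> K *m M = M.
Proof.
case=> _ BK [T KE]; split=> [BM|<-]; last by rewrite mulmxA BK mul0mx.
apply/esym/eqP; rewrite -subr_eq0 -{1}[M]mul1mx -mulmxBl KE.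
by rewrite -mulmxA BM mulmx0.
Qed.

Lemma supp_projectorP S P M : supp_projector S P -> M *m S = 0 <-> M *m P = 0.
Proof.
case=> _ PS [B PE]; split=> [MS|MP]; first by rewrite PE mulmxA MS mul0mx.
by rewrite -PS mulmxA MP mul0mx.
Qed.

Lemma ker_projector_leP B K P : ker_projector B K ->
  leproj P K <-> B *m P = 0.
Proof.
move=> kK; have [projK _ _] := kK.
by rewrite leprojP // (ker_projectorP _ kK).
Qed.

Lemma supp_projector_leP S P R : supp_projector S P -> projector R ->
  leproj P R <-> (1%:M - R) *m S = 0.
Proof.
move=> sP projR; rewrite leprojP // (supp_projectorP _ sP).
rewrite mulmxBl mul1mx; split=> [->|/eqP]; first by rewrite subrr.
by rewrite subr_eq0 => /eqP.
Qed.

Lemma ker_projector_uniq B K K' :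
  ker_projector B K -> ker_projector B K' -> K = K'.
Proof.
move=> kK kK'; have [pK BK _] := kK; have [pK' BK' _] := kK'.
by apply: leproj_anti => //; [apply/(ker_projector_leP _ kK')
  | apply/(ker_projector_leP _ kK)].
Qed.

Lemma supp_projector_uniq S P P' :
  supp_projector S P -> supp_projector S P' -> P = P'.
Proof.
move=> sP sP'; have [pP PS _] := sP; have [pP' P'S _] := sP'.
by apply: leproj_anti => //; [apply/(supp_projector_leP sP)
  | apply/(supp_projector_leP sP')] => //;
  rewrite mulmxBl mul1mx ?PS ?P'S subrr.
Qed.

Lemma pjoin_spec P Q :
  projector (pjoin P Q) /\ (img (pjoin P Q) == img P + img Q)%MS.
Proof. exact: epsilon_spec (exists_projector (img P + img Q)%MS). Qed.

Lemma pmeet_spec P Q :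
  projector (pmeet P Q) /\ (img (pmeet P Q) == img P :&: img Q)%MS.
Proof. exact: epsilon_spec (exists_projector (img P :&: img Q)%MS). Qed.

Lemma projector_pjoin P Q : projector (pjoin P Q).
Proof. by have [] := pjoin_spec P Q. Qed.

Lemma projector_pmeet P Q : projector (pmeet P Q).
Proof. by have [] := pmeet_spec P Q. Qed.

Lemma leproj_pjoin P Q M :
  leproj (pjoin P Q) M <-> leproj P M /\ leproj Q M.
Proof.
have [_ /eqmxP JE] := pjoin_spec P Q; rewrite /leproj JE addsmx_sub.
by split=> [/andP[]|[-> ->]].
Qed.

Lemma leproj_pmeet P Q M :
  leproj M (pmeet P Q) <-> leproj M P /\ leproj M Q.
Proof.
have [_ /eqmxP JE] := pmeet_spec P Q; rewrite /leproj JE sub_capmx.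
by split=> [/andP[]|[-> ->]].
Qed.

Lemma pjoinE P Q : exists S T, pjoin P Q = P *m S + Q *m T.
Proof.
by apply: sub_addsmx_trP; have [_ /andP[]] := pjoin_spec P Q.
Qed.

(** De Morgan for subspaces: the complement of an intersection is spanned by the complements. In
    this form, whatever 1 - P and 1 - Q annihilate is annihilated by the complement of the meet. *)
Lemma pmeetE P Q : projector P -> projector Q ->
  exists S T, 1%:M - pmeet P Q = S *m (1%:M - P) + T *m (1%:M - Q).
Proof.
move=> projP projQ; set K := pmeet P Q.
have projK : projector K := projector_pmeet P Q.
suff /sub_addsmxP[[S T] /= ->] : (1%:M - K <= (1%:M - P) + (1%:M - Q))%MS.
  by exists S, T.
(* [N] is annihilated by both complements, so its columns are fixed by [P] and by [Q] and lie in the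
   image of the meet. *)
rewrite submxE; set N := cokermx _.
have fixN R : projector R -> (1%:M - R <= (1%:M - P) + (1%:M - Q))%MS ->
    leproj N R.
  move=> projR; rewrite submxE => /eqP N0; apply/leprojP => //.
  by apply/esym/eqP; rewrite -subr_eq0 -{1}[N]mul1mx -mulmxBl N0.
have /(leprojP _ projK) KN : leproj N K.
  by apply/leproj_pmeet; split; apply: fixN; rewrite ?addsmxSl ?addsmxSr.
by rewrite mulmxBl mul1mx KN subrr.
Qed.

End SupportKernel.

(** * Cylindrical extensions *)

Lemma avalE (X : {fset nat}) (b : basis X) (x : X) : aval b (val x) = b x.
Proof. by rewrite /aval valK. Qed.

Lemma aval_notin (X : {fset nat}) (b : basis X) n :
  n \notin X -> aval b n = false.
Proof. by move=> nX; rewrite /aval insubN. Qed.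

Lemma basisP (X : {fset nat}) (a b : basis X) :
  (forall n, n \in X -> aval a n = aval b n) -> a = b.
Proof. by move=> ab; apply/ffunP => x; rewrite -!avalE ab // fsvalP. Qed.

Lemma aval_restr (X Y : {fset nat}) (b : basis X) n :
  aval (restr Y b) n = (n \in Y) && aval b n.
Proof.
have [nY|nY] := boolP (n \in Y); last by rewrite aval_notin.
by rewrite (avalE (restr Y b) [` nY]) ffunE.
Qed.

Lemma aval_glue (X V Z : {fset nat}) (a : basis V) (c : basis Z) n :
  aval (glue X a c) n =
    (n \in X) && (if n \in V then aval a n else aval c n).
Proof.
have [nX|nX] := boolP (n \in X); last by rewrite aval_notin.
by rewrite (avalE (glue X a c) [` nX]) ffunE.
Qed.

Lemma restr_glue (U X Z : {fset nat}) (u : basis U) (c : basis Z) :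
  U `<=` X -> restr U (glue X u c) = u.
Proof.
move=> /fsubsetP UX; apply: basisP => n nU.
by rewrite aval_restr aval_glue nU (UX n nU).
Qed.

Lemma restr_glue_disj (U X Y Z : {fset nat}) (u : basis U) (c : basis Z) :
  [disjoint Y & U] -> Y `<=` X -> restr Y (glue X u c) = restr Y c.
Proof.
move=> /fdisjointP YU /fsubsetP YX; apply: basisP => n nY.
by rewrite !aval_restr aval_glue nY (YX n nY) (negPf (YU n nY)).
Qed.

Lemma restr_glue_sub (V U X Z : {fset nat}) (u : basis U) (c : basis Z) :
  V `<=` U -> U `<=` X -> restr V (glue X u c) = restr V u.
Proof.
move=> /fsubsetP VU /fsubsetP UX; apply: basisP => n nV.
by rewrite !aval_restr aval_glue nV (VU n nV) (UX n (VU n nV)).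
Qed.

Lemma restr_glueD (U X Z : {fset nat}) (u : basis U) (c : basis Z) :
  restr (X `\` U) (glue X u c) = restr (X `\` U) c.
Proof.
apply: basisP => n nD; rewrite !aval_restr aval_glue nD.
by move: nD; rewrite inE => /andP[/negPf -> ->].
Qed.

Lemma restr_id (X : {fset nat}) (a : basis X) : restr X a = a.
Proof. by apply: basisP => n nX; rewrite aval_restr nX. Qed.

Lemma restr_restr (X Y Z : {fset nat}) (a : basis X) :
  Z `<=` Y -> restr Z (restr Y a) = restr Z a.
Proof.
move=> /fsubsetP ZY; apply: basisP => n nZ.
by rewrite !aval_restr nZ (ZY n nZ).
Qed.

Lemma glue_restr (U X : {fset nat}) (a : basis X) :
  glue X (restr U a) (restr (X `\` U) a) = a.
Proof.
apply: basisP => n nX; rewrite aval_glue !aval_restr !inE nX.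
by case: (n \in U).
Qed.

Lemma bvK (X : {fset nat}) : cancel (@bv X) (@bi X).
Proof. exact: enum_valK. Qed.

Lemma biK (X : {fset nat}) : cancel (@bi X) (@bv X).
Proof. exact: enum_rankK. Qed.

Lemma sum_basis (F : nmodType) (X : {fset nat}) (f : 'I_(Defs.dim X) -> F) :
  (\sum_i f i = \sum_(a : basis X) f (bi a))%R.
Proof.
by rewrite (reindex (@bi X)) //; exists (@bv X) => ? _; rewrite ?biK ?bvK.
Qed.

Lemma sum_glue (F : nmodType) (U X : {fset nat}) (f : basis X -> F) :
  U `<=` X ->
  (\sum_a f a =
     \sum_(u : basis U) \sum_(c : basis (X `\` U)) f (glue X u c))%R.
Proof.
move=> UX; rewrite pair_bigA.
rewrite (reindex (fun p : basis U * basis (X `\` U) => glue X p.1 p.2)) //.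
exists (fun a => (restr U a, restr (X `\` U) a)) => [[u c]|a] _ /=.
  by rewrite restr_glue // restr_glueD restr_id.
exact: glue_restr.
Qed.

Lemma extE (X Y : {fset nat}) (A : Op X) (a b : basis Y) :
  ext A Y (bi a) (bi b) =
  A (bi (restr X a)) (bi (restr X b)) *
    (restr (Y `\` X) a == restr (Y `\` X) b)%:R.
Proof. by rewrite mxE !biK. Qed.

Lemma tensE (X Y : {fset nat}) (A : Op X) (B : Op Y) (a b : basis (X `|` Y)) :
  tens A B (bi a) (bi b) =
  A (bi (restr X a)) (bi (restr X b)) * B (bi (restr Y a)) (bi (restr Y b)).
Proof. by rewrite mxE !biK. Qed.

Lemma basis_mxP (X : {fset nat}) (A B : Op X) :
  (forall a b : basis X, A (bi a) (bi b) = B (bi a) (bi b)) -> A = B.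
Proof. by move=> AB; apply/matrixP => i j; rewrite -(bvK i) -(bvK j) AB. Qed.

(** The identity factor of the extension pins all variables outside [U] to their values in [a], so
    only the assignments on [U] remain to be summed. *)
Lemma mul_extE (U X : {fset nat}) (A : Op U) (M : Op X) (a b : basis X) :
  U `<=` X ->
  (ext A X *m M) (bi a) (bi b) =
  \sum_(u : basis U) A (bi (restr U a)) (bi u) * M (bi (glue X u a)) (bi b).
Proof.
move=> UX; rewrite mxE sum_basis (sum_glue _ UX); apply: eq_bigr => u _.
rewrite (bigD1 (restr (X `\` U) a)) //= big1 => [|c ca].
  rewrite extE restr_glue // restr_glueD.
  rewrite restr_id eqxx mulr1 addr0; congr (_ * M (bi _) _).
  apply: basisP => n nX; rewrite !aval_glue aval_restr !inE nX.
  by case: (n \in U).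
rewrite extE restr_glue // restr_glueD.
by rewrite restr_id eq_sym (negPf ca) mulr0 mul0r.
Qed.

Lemma ext_mul (U X : {fset nat}) (A B : Op U) : U `<=` X ->
  ext (A *m B) X = ext A X *m ext B X.
Proof.
move=> UX; apply: basis_mxP => a b; rewrite mul_extE // extE mxE sum_basis.
rewrite mulr_suml; apply: eq_bigr => u _; rewrite extE restr_glue //.
by rewrite restr_glueD mulrA.
Qed.

Lemma ext1 (U X : {fset nat}) : U `<=` X -> ext (1%:M : Op U) X = 1%:M.
Proof.
move=> UX; apply: basis_mxP => a b; rewrite extE !mxE.
rewrite !(can_eq (@biK _)) -natrM mulnb; congr (_%:R); congr nat_of_bool.
apply/andP/eqP => [[/eqP e /eqP e']|->]; last by [].
by rewrite -(glue_restr U a) e e' glue_restr.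
Qed.

Lemma extD (U X : {fset nat}) (A B : Op U) : ext (A + B) X = ext A X + ext B X.
Proof. by apply: basis_mxP => a b; rewrite [RHS]mxE !extE mxE mulrDl. Qed.

Lemma extB (U X : {fset nat}) (A B : Op U) : ext (A - B) X = ext A X - ext B X.
Proof.
by apply: basis_mxP => a b; rewrite !extE !mxE !biK mulrBl.
Qed.

Lemma ext0 (U X : {fset nat}) : ext (0 : Op U) X = 0.
Proof. by apply: basis_mxP => a b; rewrite extE !mxE mul0r. Qed.

Lemma ext_trmxC (U X : {fset nat}) (A : Op U) : ext (A ^t*) X = (ext A X) ^t*.
Proof.
apply: basis_mxP => a b; rewrite extE !mxE !biK rmorphM /= conjC_nat.
by rewrite eq_sym.
Qed.

Lemma ext_id (X : {fset nat}) (A : Op X) : ext A X = A.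
Proof.
apply: basis_mxP => a b; rewrite extE !restr_id.
have -> : (restr (X `\` X) a == restr (X `\` X) b).
  by apply/eqP/basisP => n; rewrite fsetDv inE.
by rewrite mulr1.
Qed.

Lemma ext_ext (U Y X : {fset nat}) (A : Op U) : U `<=` Y -> Y `<=` X ->
  ext (ext A Y) X = ext A X.
Proof.
move=> UY YX; apply: basis_mxP => a b; rewrite !extE !restr_restr ?fsubsetDl //.
rewrite -mulrA -natrM mulnb; congr (_ * (nat_of_bool _)%:R).
apply/andP/eqP => [[/eqP e1 /eqP e2]|e].
  apply: basisP => n nXU; have := congr1 (aval^~ n) e1.
  have := congr1 (aval^~ n) e2; rewrite /= !aval_restr nXU /=.
  by move: nXU; rewrite !inE => /andP[-> ->]; case: (n \in Y).
split; apply/eqP/basisP => n nD; have := congr1 (aval^~ n) e;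
  rewrite /= !aval_restr nD; move: nD; rewrite !inE.
  by move=> /andP[-> /(fsubsetP YX) ->].
by move=> /andP[nY ->]; rewrite (contraNN (fsubsetP UY n) nY).
Qed.

Lemma projector_ext (U X : {fset nat}) (P : Op U) : U `<=` X ->
  projector P -> projector (ext P X).
Proof.
by move=> UX [PP Ph]; split; rewrite -?ext_mul // -?ext_trmxC ?PP ?Ph.
Qed.

Lemma psd_ext (U X : {fset nat}) (A : Op U) : U `<=` X ->
  psd A -> psd (ext A X).
Proof.
move=> UX /psd_sqrt[B ->]; rewrite ext_mul // ext_trmxC; exact: psd_gram.
Qed.

Lemma tens_ext (X Y : {fset nat}) (A : Op X) (B : Op Y) :
  [disjoint X & Y] -> tens A B = ext A (X `|` Y) *m ext B (X `|` Y).
Proof.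
move=> XY; apply: basis_mxP => a b.
rewrite mul_extE ?fsubsetUl // tensE (bigD1 (restr X b)) //= big1 ?addr0.
  rewrite extE restr_glue_disj ?fsubsetUr //; last by rewrite fdisjoint_sym.
  suff -> : restr ((X `|` Y) `\` Y) (glue (X `|` Y) (restr X b) a) ==
            restr ((X `|` Y) `\` Y) b by rewrite mulr1.
  apply/eqP/basisP => n; rewrite !aval_restr aval_glue !inE aval_restr.
  by case/andP => /negPf ->; rewrite orbF => ->.
move=> x xb; rewrite extE; case: eqP => [e|]; last by rewrite !mulr0.
case/eqP: xb; apply: basisP => n nX; have := congr1 (aval^~ n) e.
have /negPf nY := fdisjointP XY n nX.
by rewrite /= !aval_restr aval_glue !inE nX nY.
Qed.

(** Together with [tens_ext] this yields that operators on disjoint systems commute. *)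
Lemma tens_extC (X Y : {fset nat}) (A : Op X) (B : Op Y) :
  [disjoint X & Y] -> tens A B = ext B (X `|` Y) *m ext A (X `|` Y).
Proof.
move=> XY; apply: basis_mxP => a b.
rewrite mul_extE ?fsubsetUr // tensE (bigD1 (restr Y b)) //= big1 ?addr0.
  rewrite extE restr_glue_disj ?fsubsetUl // mulrC.
  suff -> : restr ((X `|` Y) `\` X) (glue (X `|` Y) (restr Y b) a) ==
            restr ((X `|` Y) `\` X) b by rewrite mulr1.
  apply/eqP/basisP => n; rewrite !aval_restr aval_glue !inE aval_restr.
  by case/andP => /negPf -> /= ->.
move=> x xb; rewrite extE; case: eqP => [e|]; last by rewrite !mulr0.
case/eqP: xb; apply: basisP => n nY; have := congr1 (aval^~ n) e.
have /negPf nX : n \notin X by apply: contraTN nY => nX; apply: fdisjointP nX.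
by rewrite /= !aval_restr aval_glue !inE nX nY.
Qed.

(** * Partial trace, and super-operators acting on part of a system *)

Definition ptr (U : {fset nat}) (X : {fset nat}) (rho : Op X) : Op U :=
  \matrix_(i, j) \sum_(c : basis (X `\` U))
    rho (bi (glue X (bv i) c)) (bi (glue X (bv j) c)).

Lemma tr_ext (U X : {fset nat}) (A : Op U) (rho : Op X) : U `<=` X ->
  \tr (ext A X *m rho) = \tr (A *m ptr U rho).
Proof.
move=> UX; rewrite /mxtrace !sum_basis (sum_glue _ UX).
apply: eq_bigr => u _; rewrite mxE sum_basis.
under [RHS]eq_bigr => u' _ do rewrite mxE !biK mulr_sumr.
rewrite exchange_big /=; apply: eq_bigr => c _.
rewrite mul_extE // restr_glue //; apply: eq_bigr => u' _.
congr (_ * rho (bi _) _); apply: basisP => n nX; rewrite !aval_glue nX.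
by case: (n \in U).
Qed.

Section ExtS.
Variables (V : {fset nat}) (E : {linear Op V -> Op V}) (X : {fset nat}).

(** The block of [rho] on H_V selected by the values of [a] and [b] outside [V]; [extS E] applies
    [E] to each such block separately. *)
Definition slice (rho : Op X) (a b : basis X) : Op V :=
  \matrix_(k, l) rho (bi (glue X (bv k) (restr (X `\` V) a)))
                     (bi (glue X (bv l) (restr (X `\` V) b))).

Lemma extSE (rho : Op X) (a b : basis X) :
  extS E rho (bi a) (bi b) =
  E (slice rho a b) (bi (restr V a)) (bi (restr V b)).
Proof. by rewrite mxE !biK. Qed.

Lemma extS_linear : linear (@extS V E X).
Proof.
move=> c rho sigma; apply: basis_mxP => a b.
rewrite !mxE !biK.
set M := (M in E M _ _ = _); set M1 := (M1 in c * E M1 _ _ + _).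
set M2 := (M2 in _ + E M2 _ _).
have -> : M = c *: M1 + M2 by apply/matrixP => k l; rewrite !mxE.
by rewrite linearP !mxE.
Qed.

HB.instance Definition _ :=
  GRing.isLinear.Build C (Op X) (Op X) *:%R (@extS V E X) extS_linear.

End ExtS.

Section ExtSTheory.
Variables (V : {fset nat}) (E : {linear Op V -> Op V}).

(** Since [W] avoids [V], multiplying by [R] only forms linear combinations of the blocks of [rho],
    and [E] is linear. *)
Lemma extS_mul_ext (W X : {fset nat}) (R : Op W) (rho : Op X) :
  [disjoint W & V] -> W `<=` X -> V `<=` X ->
  extS E (ext R X *m rho) = ext R X *m extS E rho.
Proof.
move=> WV WX VX; apply: basis_mxP => a b.
rewrite mul_extE // extSE.
have -> : slice V (ext R X *m rho) a b = \sum_(w : basis W)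
    R (bi (restr W a)) (bi w) *: slice V rho (glue X w a) b.
  apply: basis_mxP => k l; rewrite mxE !biK mul_extE // summxE.
  rewrite restr_glue_disj // restr_restr; last first.
    by rewrite fsubsetD WX.
  apply: eq_bigr => w _; rewrite !mxE !biK; congr (_ * rho (bi _) _).
  apply: basisP => n nX; rewrite !(aval_glue, aval_restr) !inE nX.
  have [nW|nW] := boolP (n \in W) => /=; last by case: (n \in V).
  by rewrite (negPf (fdisjointP WV n nW)).
rewrite linear_sum summxE; apply: eq_bigr => w _.
rewrite linearZ mxE extSE restr_glue_disj //.
by rewrite fdisjoint_sym.
Qed.

(** Tracing out variables outside [V] sums blocks, hence passes through the linear map [E]. By
    duality this becomes [dualS_ext]. *)
Lemma ptr_extS (U X : {fset nat}) (rho : Op X) : V `<=` U -> U `<=` X ->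
  ptr U (extS E rho) = extS E (ptr U rho).
Proof.
move=> VU UX; apply: basis_mxP => u u'; rewrite mxE !biK extSE.
under eq_bigr => c _ do rewrite extSE !restr_glue_sub //.
rewrite -summxE -linear_sum; congr (E _ _ _).
apply: basis_mxP => k l; rewrite summxE !mxE; apply: eq_bigr => c _.
have gl (v : basis V) (w : basis U) :
    glue X v (restr (X `\` V) (glue X w c)) =
    glue X (glue U v (restr (U `\` V) w)) c.
  apply: basisP => n nX; rewrite !(aval_glue, aval_restr) !inE nX.
  have [nV|nV] := boolP (n \in V); first by rewrite (fsubsetP VU).
  by case: (n \in U).
by rewrite mxE !biK !gl.
Qed.

End ExtSTheory.

(** * The trace adjoint of a super-operator *)

Section ExtSExt.
Variables (V : {fset nat}) (E : {linear Op V -> Op V}).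

Lemma extS_ext (U X : {fset nat}) (A : Op U) : V `<=` U -> U `<=` X ->
  extS E (ext A X) = ext (extS E A) X.
Proof.
move=> VU UX; have VX := fsubset_trans VU UX.
have VD (a : basis X) (k : basis V) : restr (X `\` U)
    (glue X k (restr (X `\` V) a)) = restr (X `\` U) a.
  apply: basisP => n; rewrite !(aval_restr, aval_glue) !inE.
  case/andP=> nU nX; rewrite nU nX /=.
  by rewrite (negPf (contraNN (fsubsetP VU n) nU)).
have VR (a : basis X) (k : basis V) : restr U
    (glue X k (restr (X `\` V) a)) = glue U k (restr (U `\` V) (restr U a)).
  apply: basisP => n nU; rewrite !(aval_restr, aval_glue) !inE nU.
  by rewrite (fsubsetP UX n nU); case: (n \in V).
apply: basis_mxP => a b; rewrite extSE extE extSE !restr_restr //.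
have sc (c : C) (M : Op V) i j : E M i j * c = E (c *: M) i j.
  by rewrite linearZ mxE mulrC.
rewrite sc; congr (E _ _ _).
by apply: basis_mxP => k l; rewrite !mxE !biK !VD !VR mulrC.
Qed.

Lemma extS_id (rho : Op V) : extS E rho = E rho.
Proof.
apply: basis_mxP => a b; rewrite extSE !restr_id; congr (E _ _ _).
have gl (k c : basis V) : glue V k (restr (V `\` V) c) = k.
  by apply: basisP => n nV; rewrite aval_glue nV.
by apply: basis_mxP => k l; rewrite mxE !biK !gl.
Qed.

(** Pairing an operator with [delta_mx j i] under the trace reads off its entry [i j], so
    adjointness forces this formula. *)
Definition dualS (X : {fset nat}) (Q : Op X) : Op X :=
  \matrix_(i, j) \tr (Q *m extS E (delta_mx j i)).

Lemma tr_dualS (X : {fset nat}) (Q rho : Op X) :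
  \tr (dualS Q *m rho) = \tr (Q *m extS E rho).
Proof.
rewrite [rho in RHS]matrix_sum_delta linear_sum mulmx_sumr raddf_sum.
rewrite mxtrace_mulC; apply: eq_bigr => i _.
rewrite mxE linear_sum mulmx_sumr raddf_sum; apply: eq_bigr => j _.
by rewrite mxE linearZ /= -scalemxAr mxtraceZ.
Qed.

End ExtSExt.

Section Dual.
Variables (V : {fset nat}) (E : {linear Op V -> Op V}).

Lemma dualSB (X : {fset nat}) (P Q : Op X) :
  dualS E (P - Q) = dualS E P - dualS E Q.
Proof.
apply: mxtrace_mul_inj => M.
by rewrite mulmxBl linearB /= !tr_dualS mulmxBl linearB.
Qed.

Lemma dualSD (X : {fset nat}) (P Q : Op X) :
  dualS E (P + Q) = dualS E P + dualS E Q.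
Proof.
apply: mxtrace_mul_inj => M.
by rewrite mulmxDl linearD /= !tr_dualS mulmxDl linearD.
Qed.

Lemma dualS0 (X : {fset nat}) : dualS E (0 : Op X) = 0.
Proof. by rewrite -[X in dualS E X](subrr 0) dualSB subrr. Qed.

Lemma dualS_ext (U X : {fset nat}) (Q : Op U) : V `<=` U -> U `<=` X ->
  dualS E (ext Q X) = ext (dualS E Q) X.
Proof.
move=> VU UX; apply: mxtrace_mul_inj => M.
by rewrite tr_dualS !tr_ext // ptr_extS // tr_dualS.
Qed.

Lemma dualS_mul_ext (W X : {fset nat}) (R : Op W) (M : Op X) :
  [disjoint W & V] -> W `<=` X -> V `<=` X ->
  dualS E (M *m ext R X) = dualS E M *m ext R X.
Proof.
move=> WV WX VX; apply: mxtrace_mul_inj => N.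
by rewrite tr_dualS -!mulmxA tr_dualS extS_mul_ext.
Qed.

Hypothesis DE : DProg E.

Lemma psd_extS (X : {fset nat}) (rho : Op X) :
  V `<=` X -> psd rho -> psd (extS E rho).
Proof. by move=> VX; apply: DE.1. Qed.

Lemma psd_dualS (X : {fset nat}) (Q : Op X) :
  V `<=` X -> psd Q -> psd (dualS E Q).
Proof.
move=> VX pQ; apply/psd_trP => rho prho; rewrite tr_dualS.
by apply: psd_tr_mul_ge0 => //; apply: psd_extS.
Qed.

(** The trace bound is assumed on H_V only. There it says that 1 - D(1) is positive, and this
    operator and its positivity extend to larger systems. *)
Lemma psd_subr_dualS1 (X : {fset nat}) :
  V `<=` X -> psd (1%:M - dualS E (1%:M : Op X)).
Proof.
move=> VX; rewrite -(ext1 VX) dualS_ext // -extB; apply: psd_ext => //.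
apply/psd_trP => rho prho; rewrite mulmxBl linearB /= tr_dualS !mul1mx subr_ge0.
by rewrite extS_id; apply: DE.2.
Qed.

Lemma psd_subr_dualS (X : {fset nat}) (Q : Op X) :
  V `<=` X -> projector Q -> psd (1%:M - dualS E Q).
Proof.
move=> VX projQ.
(* The first summand measures the loss of trace, the second the weight that ends outside [Q]. *)
have -> : 1%:M - dualS E Q = (1%:M - dualS E 1%:M) + dualS E (1%:M - Q).
  by rewrite dualSB addrA subrK.
apply: psdD; first exact: psd_subr_dualS1.
by apply: psd_dualS => //; apply/projector_psd/projectorC.
Qed.

Lemma tr_extS_le (X : {fset nat}) (rho : Op X) :
  V `<=` X -> psd rho -> \tr (extS E rho) <= \tr rho.
Proof.
move=> VX prho; have := psd_tr_mul_ge0 (psd_subr_dualS1 VX) prho.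
by rewrite mulmxBl linearB /= tr_dualS !mul1mx subr_ge0.
Qed.

(** Both products have positive factors and the same trace. This exchange between a kernel of D and
    an image under F is what relates [wlp] to [sp]. *)
Lemma dualSC_mul_eq0 (X : {fset nat}) (P Q : Op X) : V `<=` X ->
  projector P -> projector Q ->
  dualS E (1%:M - Q) *m P = 0 <-> (1%:M - Q) *m extS E P = 0.
Proof.
move=> VX /projector_psd pP /projectorC/projector_psd pQ.
split=> [h|h]; apply: psd_tr_mul_eq0 => //; rewrite ?tr_dualS ?h ?linear0 //.
- exact: psd_extS.
- by rewrite -tr_dualS h linear0.
- exact: psd_dualS.
Qed.

(** The trace of the left side splits into two nonnegative terms, the trace lost by F on P and the
    part of F(P) outside Q; it vanishes exactly when both do. *)
Lemma subr_dualS_mul_eq0 (X : {fset nat}) (P Q : Op X) : V `<=` X ->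
  projector P -> projector Q ->
  (1%:M - dualS E Q) *m P = 0 <->
  (1%:M - Q) *m extS E P = 0 /\ \tr (extS E P) = \tr P.
Proof.
move=> VX projP projQ; have pP := projector_psd projP.
have pFP := psd_extS VX pP; have pQC := projector_psd (projectorC projQ).
have trE : \tr ((1%:M - dualS E Q) *m P) =
    (\tr P - \tr (extS E P)) + \tr ((1%:M - Q) *m extS E P).
  by rewrite !mulmxBl !linearB /= tr_dualS !mul1mx addrA subrK.
have h1 := psd_tr_mul_ge0 pQC pFP.
have h2 : 0 <= \tr P - \tr (extS E P) by rewrite subr_ge0; apply: tr_extS_le.
split=> [h|[h e]].
  move: trE; rewrite h linear0 => /esym/eqP; rewrite paddr_eq0 //.
  case/andP; rewrite subr_eq0 => /eqP e /eqP e'.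
  by split=> //; apply: psd_tr_mul_eq0.
apply: psd_tr_mul_eq0 => //; first exact: psd_subr_dualS.
by rewrite trE h e subrr linear0 addr0.
Qed.

End Dual.

(** * Predicate transformers *)

Lemma psd_pdoP (X : {fset nat}) (A : Op X) :
  (forall rho, pdo rho -> 0 <= \tr (A *m rho)) -> psd A.
Proof.
move=> h; apply/psd_trP => rho prho.
have t0 : 0 <= \tr rho.
  by rewrite -[rho]mul1mx; apply: psd_tr_mul_ge0 => //;
    apply/projector_psd/projector1.
(* Normalizing by one plus the trace gives a partial density operator without treating trace zero
   apart. *)
have t1 : 0 < 1 + \tr rho by rewrite ltr_wpDr.
have /h : pdo ((1 + \tr rho)^-1 *: rho).
  split=> [v|].
    by rewrite -scalemxAr -scalemxAl mxE mulr_ge0 ?invr_ge0 ?(ltW t1).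
  by rewrite mxtraceZ mulrC ler_pdivrMr // mul1r lerDr.
by rewrite -scalemxAr mxtraceZ pmulr_rge0 // invr_gt0.
Qed.

Section Transformers.
Variables (V : {fset nat}) (E : {linear Op V -> Op V}).
Hypothesis DE : DProg E.

(** The inequality on the smallest system implies it on all larger ones, as D commutes with
    extension. Keeping [U] as a variable tied by an equation lets each use replace the nested union
    by [V]|[W]. *)
Lemma sat_tot_psdP (U U1 U2 : {fset nat}) (P : Op U1) (Q : Op U2) :
  V `|` U1 `|` U2 = U ->
  sat_tot E P Q <-> psd (dualS E (ext Q U) - ext P U).
Proof.
move=> UE; rewrite /sat_tot UE.
have /andP[/andP[VU U1U] U2U] : (V `<=` U) && (U1 `<=` U) && (U2 `<=` U).
  by rewrite -!fsubUset UE.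
split=> [h|h X UX rho [prho _]].
  apply: psd_pdoP => rho /(h _ (fsubset_refl U)).
  by rewrite mulmxBl linearB /= tr_dualS subr_ge0.
have := psd_tr_mul_ge0 (psd_ext UX h) prho.
rewrite extB -dualS_ext // !ext_ext // mulmxBl linearB /= tr_dualS.
by rewrite subr_ge0.
Qed.

Lemma sat_par_psdP (U U1 U2 : {fset nat}) (P : Op U1) (Q : Op U2) :
  V `|` U1 `|` U2 = U ->
  sat_par E P Q <-> psd (1%:M - dualS E (1%:M - ext Q U) - ext P U).
Proof.
move=> UE; rewrite /sat_par UE.
have /andP[/andP[VU U1U] U2U] : (V `<=` U) && (U1 `<=` U) && (U2 `<=` U).
  by rewrite -!fsubUset UE.
have trE (X : {fset nat}) (rho : Op X) : U `<=` X ->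
    \tr ((1%:M - dualS E (1%:M - ext Q X) - ext P X) *m rho) =
    \tr (ext Q X *m extS E rho) + \tr rho - \tr (extS E rho) -
    \tr (ext P X *m rho).
  move=> UX; rewrite !mulmxBl !linearB /= tr_dualS mulmxBl linearB /= !mul1mx.
  by rewrite opprB addrA [\tr rho + _]addrC.
split=> [h|h X UX rho [prho _]].
  apply: psd_pdoP => rho /(h _ (fsubset_refl U)).
  by rewrite trE // subr_ge0.
have := psd_tr_mul_ge0 (psd_ext UX h) prho.
rewrite !extB ext1 // -dualS_ext // extB ext1 // !ext_ext // trE //.
by rewrite subr_ge0.
Qed.

Lemma sat_totP (U U1 U2 : {fset nat}) (P : Op U1) (Q : Op U2) :
  V `|` U1 `|` U2 = U -> projector P -> projector Q ->
  sat_tot E P Q <-> (1%:M - dualS E (ext Q U)) *m ext P U = 0.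
Proof.
move=> UE projP projQ; rewrite (sat_tot_psdP _ _ UE).
have /andP[/andP[VU U1U] U2U] : (V `<=` U) && (U1 `<=` U) && (U2 `<=` U).
  by rewrite -!fsubUset UE.
have projP' := projector_ext U1U projP; have projQ' := projector_ext U2U projQ.
rewrite psd_sub_projector_mul //.
- rewrite mulmxBl mul1mx; split=> [->|/eqP]; first by rewrite subrr.
  by rewrite subr_eq0 => /eqP.
- by apply: psd_dualS => //; apply: projector_psd.
- exact: psd_subr_dualS.
Qed.

Lemma sat_parP (U U1 U2 : {fset nat}) (P : Op U1) (Q : Op U2) :
  V `|` U1 `|` U2 = U -> projector P -> projector Q ->
  sat_par E P Q <-> dualS E (1%:M - ext Q U) *m ext P U = 0.
Proof.
move=> UE projP projQ; rewrite (sat_par_psdP _ _ UE).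
have /andP[/andP[VU U1U] U2U] : (V `<=` U) && (U1 `<=` U) && (U2 `<=` U).
  by rewrite -!fsubUset UE.
have projP' := projector_ext U1U projP.
have projQ' := projectorC (projector_ext U2U projQ).
rewrite psd_sub_projector_mul //.
- rewrite mulmxBl mul1mx; split=> [e|->]; last by rewrite subr0.
  by rewrite -[LHS](subKr (ext P U)) e subrr.
- exact: psd_subr_dualS.
- by rewrite subKr; apply: psd_dualS => //; apply: projector_psd.
Qed.

(** * Kernel and support descriptions of the transformers, and clauses (1) to (6) *)

Section Pre.
Variable W : {fset nat}.
Let VW : V `<=` V `|` W := fsubsetUl V W.
Let WW : W `<=` V `|` W := fsubsetUr V W.

Let UE1 : V `|` (V `|` W) `|` W = V `|` W.
Proof. by rewrite fsetUA fsetUid -fsetUA fsetUid. Qed.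

Let UE2 : V `|` W `|` (V `|` W) = V `|` W.
Proof. exact: fsetUid. Qed.

(** The valid preconditions are exactly the projectors below the kernel projector [K]. So [K] shows
    that a largest one exists, which makes the choice operator meaningful, and antisymmetry
    identifies the chosen projector with [K]. *)
Lemma wp_ker (Q : Op W) : projector Q ->
  ker_projector (1%:M - dualS E (ext Q (V `|` W))) (wp E Q).
Proof.
move=> projQ; have [K kK] := exists_ker_projector
  (1%:M - dualS E (ext Q (V `|` W))).
have [projK BK _] := kK.
have satP (P : Op (V `|` W)) : projector P -> sat_tot E P Q <-> leproj P K.
  by move=> projP; rewrite (sat_totP UE1) // ext_id (ker_projector_leP _ kK).
have [] : projector (wp E Q) /\ sat_tot E (wp E Q) Q /\ forall P',
    projector P' -> sat_tot E P' Q -> leproj P' (wp E Q).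
  apply: (epsilon_spec (inhabits (0 : Op (V `|` W)))
    (fun P : Op (V `|` W) => projector P /\ sat_tot E P Q /\ forall P',
    projector P' -> sat_tot E P' Q -> leproj P' P)).
  exists K; split=> //; split=> [|P' projP' /(satP _ projP')//].
  by apply/satP => //; apply: leproj_refl.
move=> projw [satw maxw]; suff -> : wp E Q = K by [].
apply: leproj_anti => //; first exact/satP.
by apply: maxw => //; apply/satP => //; apply: leproj_refl.
Qed.

Lemma wlp_ker (Q : Op W) : projector Q ->
  ker_projector (dualS E (1%:M - ext Q (V `|` W))) (wlp E Q).
Proof.
move=> projQ; have [K kK] := exists_ker_projector
  (dualS E (1%:M - ext Q (V `|` W))).
have [projK BK _] := kK.
have satP (P : Op (V `|` W)) : projector P -> sat_par E P Q <-> leproj P K.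
  by move=> projP; rewrite (sat_parP UE1) // ext_id (ker_projector_leP _ kK).
have [] : projector (wlp E Q) /\ sat_par E (wlp E Q) Q /\ forall P',
    projector P' -> sat_par E P' Q -> leproj P' (wlp E Q).
  apply: (epsilon_spec (inhabits (0 : Op (V `|` W)))
    (fun P : Op (V `|` W) => projector P /\ sat_par E P Q /\ forall P',
    projector P' -> sat_par E P' Q -> leproj P' P)).
  exists K; split=> //; split=> [|P' projP' /(satP _ projP')//].
  by apply/satP => //; apply: leproj_refl.
move=> projw [satw maxw]; suff -> : wlp E Q = K by [].
apply: leproj_anti => //; first exact/satP.
by apply: maxw => //; apply/satP => //; apply: leproj_refl.
Qed.

Lemma sp_supp (P : Op W) : projector P ->
  supp_projector (extS E (ext P (V `|` W))) (sp E P).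
Proof.
move=> projP; have projP' := projector_ext WW projP.
have [K sK] := exists_supp_projector (extS E (ext P (V `|` W))).
have [projK KS _] := sK.
have satP (R : Op (V `|` W)) : projector R -> sat_par E P R <-> leproj K R.
  move=> projR; rewrite (sat_parP UE2) // ext_id dualSC_mul_eq0 //.
  by rewrite (supp_projector_leP sK).
have [] : projector (sp E P) /\ sat_par E P (sp E P) /\ forall R',
    projector R' -> sat_par E P R' -> leproj (sp E P) R'.
  apply: (epsilon_spec (inhabits (0 : Op (V `|` W)))
    (fun R : Op (V `|` W) => projector R /\ sat_par E P R /\ forall R',
    projector R' -> sat_par E P R' -> leproj R R')).
  exists K; split=> //; split=> [|R' projR' /(satP _ projR')//].
  by apply/satP => //; apply: leproj_refl.
move=> projw [satw maxw]; suff -> : sp E P = K by [].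
apply: leproj_anti => //; last exact/satP.
by apply: maxw => //; apply/satP => //; apply: leproj_refl.
Qed.

Lemma projector_wp (Q : Op W) : projector Q -> projector (wp E Q).
Proof. by case/wp_ker. Qed.

Lemma projector_wlp (Q : Op W) : projector Q -> projector (wlp E Q).
Proof. by case/wlp_ker. Qed.

Lemma projector_sp (Q : Op W) : projector Q -> projector (sp E Q).
Proof. by case/sp_supp. Qed.

Lemma leproj_wp (Q : Op W) (M : Op (V `|` W)) : projector Q -> projector M ->
  leproj M (wp E Q) <->
  (1%:M - ext Q (V `|` W)) *m extS E M = 0 /\ \tr (extS E M) = \tr M.
Proof.
move=> projQ projM; rewrite (ker_projector_leP _ (wp_ker projQ)).
by rewrite subr_dualS_mul_eq0 //; apply: projector_ext.
Qed.

Lemma leproj_wlp (Q : Op W) (M : Op (V `|` W)) : projector Q -> projector M ->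
  leproj M (wlp E Q) <-> (1%:M - ext Q (V `|` W)) *m extS E M = 0.
Proof.
move=> projQ projM; rewrite (ker_projector_leP _ (wlp_ker projQ)).
by rewrite dualSC_mul_eq0 //; apply: projector_ext.
Qed.

Lemma leproj_sp (P : Op W) (R : Op (V `|` W)) : projector P -> projector R ->
  leproj (sp E P) R <-> dualS E (1%:M - R) *m ext P (V `|` W) = 0.
Proof.
move=> projP projR; rewrite (supp_projector_leP (sp_supp projP)) //.
by rewrite dualSC_mul_eq0 //; apply: projector_ext.
Qed.

(** A common interface for [wp] and [wlp]: the side condition [c], trace preservation for [wp] and
    nothing for [wlp], is independent of the postcondition. *)
Lemma leproj_precondition (xp : Op W -> Op (V `|` W)) :
  xp = @wp V E W \/ xp = @wlp V E W ->
  exists c : Op (V `|` W) -> Prop, forall Q, projector Q -> projector (xp Q) /\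
    forall M, projector M -> leproj M (xp Q) <->
      (1%:M - ext Q (V `|` W)) *m extS E M = 0 /\ c M.
Proof.
case=> ->.
  exists (fun M => \tr (extS E M) = \tr M) => Q projQ.
  by split=> [|M projM]; [apply: projector_wp | apply: leproj_wp].
exists (fun=> True) => Q projQ; split=> [|M projM]; first exact: projector_wlp.
by rewrite leproj_wlp //; split=> [|[]].
Qed.

Lemma wp0 : wp E (0 : Op W) = 0.
Proof.
have [_ + _] := wp_ker (projector0 W).
by rewrite ext0 dualS0 subr0 mul1mx.
Qed.

Lemma sp0 : sp E (0 : Op W) = 0.
Proof.
have [_ _ [B]] := sp_supp (projector0 W).
by rewrite ext0 linear0 mul0mx.
Qed.

Lemma wlp1 : wlp E (1%:M : Op W) = 1%:M.
Proof.
have [_ _ [T]] := wlp_ker (projector1 W).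
rewrite ext1 // subrr dualS0 mulmx0 => /eqP.
by rewrite subr_eq0 => /eqP.
Qed.

Lemma precondition_mono (xp : Op W -> Op (V `|` W)) (P Q : Op W) :
  xp = @wp V E W \/ xp = @wlp V E W -> projector P -> projector Q ->
  leproj P Q -> leproj (xp P) (xp Q).
Proof.
move=> /leproj_precondition[c h] projP projQ /(leprojP _ projQ) QP.
have [projx hP] := h _ projP; have [_ hQ] := h _ projQ.
have /(hP _ projx)[PF cx] := leproj_refl (xp P).
apply/hQ => //; split=> //.
(* From Q P = P, the complement of Q factors through the complement of P, which already annihilates
   the output. *)
have -> : 1%:M - ext Q (V `|` W) =
    (1%:M - ext Q (V `|` W)) *m (1%:M - ext P (V `|` W)).
  rewrite mulmxBr mulmx1 mulmxBl mul1mx -ext_mul // QP.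
  by rewrite subrr subr0.
by rewrite -mulmxA PF mulmx0.
Qed.

Lemma sp_mono (P Q : Op W) : projector P -> projector Q ->
  leproj P Q -> leproj (sp E P) (sp E Q).
Proof.
move=> projP projQ /(leprojP _ projQ) QP.
have projS := projector_sp projQ.
have /(leproj_sp projQ projS) h := leproj_refl (sp E Q).
by apply/leproj_sp => //; rewrite -QP ext_mul // mulmxA h mul0mx.
Qed.

Lemma precondition_pmeet (xp : Op W -> Op (V `|` W)) (P Q : Op W) :
  xp = @wp V E W \/ xp = @wlp V E W -> projector P -> projector Q ->
  xp (pmeet P Q) = pmeet (xp P) (xp Q).
Proof.
move=> xpE projP projQ; have projM := projector_pmeet P Q.
have [MP MQ] := iffLR (leproj_pmeet _ _ _) (leproj_refl (pmeet P Q)).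
have [c h] := leproj_precondition xpE.
have [projxP hP] := h _ projP; have [projxQ hQ] := h _ projQ.
have [projx hM] := h _ projM.
have projK := projector_pmeet (xp P) (xp Q).
apply: leproj_anti => //.
  by apply/leproj_pmeet; split; apply: precondition_mono.
have [] := iffLR (leproj_pmeet _ _ _) (leproj_refl (pmeet (xp P) (xp Q))).
move=> /(hP _ projK)[FP cK] /(hQ _ projK)[FQ _]; apply/hM => //; split=> //.
(* The complement of the meet is a combination of two operators that both annihilate the output. The
   side condition [c] was taken from [P] alone. *)
have [S [T ME]] := pmeetE projP projQ.
rewrite -(ext1 WW) -extB ME extD !ext_mul // !extB ext1 // mulmxDl.
by rewrite -!mulmxA FP FQ !mulmx0 addr0.
Qed.

Lemma sp_pmeet (P Q : Op W) : projector P -> projector Q ->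
  leproj (sp E (pmeet P Q)) (pmeet (sp E P) (sp E Q)).
Proof.
move=> projP projQ; have projM := projector_pmeet P Q.
have [MP MQ] := iffLR (leproj_pmeet _ _ _) (leproj_refl (pmeet P Q)).
by apply/leproj_pmeet; split; apply: sp_mono.
Qed.

Lemma precondition_pjoin (xp : Op W -> Op (V `|` W)) (P Q : Op W) :
  xp = @wp V E W \/ xp = @wlp V E W -> projector P -> projector Q ->
  leproj (pjoin (xp P) (xp Q)) (xp (pjoin P Q)).
Proof.
move=> xpE projP projQ; have projJ := projector_pjoin P Q.
have [JP JQ] := iffLR (leproj_pjoin _ _ _) (leproj_refl (pjoin P Q)).
by apply/leproj_pjoin; split; apply: precondition_mono.
Qed.

Lemma sp_pjoin (P Q : Op W) : projector P -> projector Q ->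
  pjoin (sp E P) (sp E Q) = sp E (pjoin P Q).
Proof.
move=> projP projQ; have projJ := projector_pjoin P Q.
have [JP JQ] := iffLR (leproj_pjoin _ _ _) (leproj_refl (pjoin P Q)).
have projR := projector_pjoin (sp E P) (sp E Q).
have projS := projector_sp projJ.
apply: leproj_anti => //.
  by apply/leproj_pjoin; split; apply: sp_mono.
have [] := iffLR (leproj_pjoin _ _ _) (leproj_refl (pjoin (sp E P) (sp E Q))).
move=> /(leproj_sp projP projR) FP /(leproj_sp projQ projR) FQ.
(* The join factors as P S + Q T, and D(1 - R), for R the join of the two postconditions,
   annihilates P and Q from the left. *)
apply/leproj_sp => //; have [S [T ->]] := pjoinE P Q.
by rewrite extD !ext_mul // mulmxDr !mulmxA FP FQ !mul0mx addr0.
Qed.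

End Pre.
End Transformers.

(** * Tensor products *)

Lemma ext_comm (X Y : {fset nat}) (A : Op X) (B : Op Y) : [disjoint X & Y] ->
  ext A (X `|` Y) *m ext B (X `|` Y) = ext B (X `|` Y) *m ext A (X `|` Y).
Proof. by move=> XY; rewrite -tens_ext // tens_extC. Qed.

Lemma projector_tens (X Y : {fset nat}) (P : Op X) (Q : Op Y) :
  [disjoint X & Y] -> projector P -> projector Q -> projector (tens P Q).
Proof.
move=> XY projP projQ; rewrite tens_ext //.
by apply: projector_mulC; rewrite ?ext_comm //; apply: projector_ext;
  rewrite ?fsubsetUl ?fsubsetUr.
Qed.

Lemma ext_tens (X Y Z : {fset nat}) (A : Op X) (B : Op Y) :
  [disjoint X & Y] -> X `|` Y `<=` Z ->
  ext (tens A B) Z = ext A Z *m ext B Z.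
Proof.
move=> XY XYZ.
by rewrite tens_ext // ext_mul // !ext_ext ?fsubsetUl ?fsubsetUr.
Qed.

(** The two sides of clause (7) live on [V]|[(W]|[W')] and [(V]|[W)]|[W'], equal sets but not
    convertible types. Stating the underlying operator as a family [F] over all systems lets the
    equality be substituted away. *)
Lemma leprojX_ker (X Y : {fset nat}) (F : forall Z : {fset nat}, Op Z)
    (K : Op X) (K' : Op Y) : X = Y ->
  F X *m K = 0 -> ker_projector (F Y) K' -> leprojX K K'.
Proof.
move=> XY; subst Y; rewrite /leprojX fsetUid !ext_id => FK kK.
exact/(ker_projector_leP _ kK).
Qed.

Lemma eqopX_ker (X Y : {fset nat}) (F : forall Z : {fset nat}, Op Z)
    (K : Op X) (K' : Op Y) : X = Y ->
  ker_projector (F X) K -> ker_projector (F Y) K' -> eqopX K K'.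
Proof.
move=> XY; subst Y; rewrite /eqopX fsetUid !ext_id.
exact: ker_projector_uniq.
Qed.

Lemma eqopX_supp (X Y : {fset nat}) (F : forall Z : {fset nat}, Op Z)
    (K : Op X) (K' : Op Y) : X = Y ->
  supp_projector (F X) K -> supp_projector (F Y) K' -> eqopX K K'.
Proof.
move=> XY; subst Y; rewrite /eqopX fsetUid !ext_id.
exact: supp_projector_uniq.
Qed.

(** For use when no explicit factor of 1 - K through B is at hand, as for the tensor product under
    [wp]. *)
Lemma ker_projectorI (X : {fset nat}) (B K : Op X) : projector K ->
  B *m K = 0 -> (forall M : Op X, B *m M = 0 -> K *m M = M) ->
  ker_projector B K.
Proof.
move=> projK BK h; have [K' kK'] := exists_ker_projector B.
have [projK' BK' _] := kK'; suff -> : K = K' by [].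
apply: leproj_anti => //; first exact/(ker_projector_leP _ kK').
by apply/leprojP => //; apply: h.
Qed.

Section Tensor.
Variables (V : {fset nat}) (E : {linear Op V -> Op V}).
Variables (W W' : {fset nat}) (Q : Op W) (R : Op W').
Hypotheses (DE : DProg E) (projQ : projector Q) (projR : projector R).
Hypothesis disj : [disjoint W' & V `|` W].

Let U := V `|` W.
Let Z := U `|` W'.
Let VU : V `<=` U := fsubsetUl V W.
Let WU : W `<=` U := fsubsetUr V W.
Let UZ : U `<=` Z := fsubsetUl U W'.
Let WZ' : W' `<=` Z := fsubsetUr U W'.
Let VZ : V `<=` Z := fsubset_trans VU UZ.
Let ZE : V `|` (W `|` W') = Z := fsetUA V W W'.

Let disjU : [disjoint U & W'].
Proof. by rewrite fdisjoint_sym. Qed.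

Let disjV : [disjoint W' & V].
Proof. by move: disj; rewrite fdisjointXU => /andP[]. Qed.

Let disjW : [disjoint W & W'].
Proof.
by rewrite fdisjoint_sym; move: disj; rewrite fdisjointXU => /andP[].
Qed.

Let projQR : projector (tens Q R).
Proof. exact: projector_tens. Qed.

Let rr : ext R Z *m ext R Z = ext R Z.
Proof. by rewrite -ext_mul // projR.1. Qed.

Let comm (A : Op U) : ext A Z *m ext R Z = ext R Z *m ext A Z.
Proof. exact: ext_comm. Qed.

Let ext_tensQR : ext (tens Q R) Z = ext (ext Q U) Z *m ext R Z.
Proof. by rewrite ext_tens ?ext_ext // -ZE fsubsetUr. Qed.

Lemma wp_tens : eqopX (wp E (tens Q R)) (tens (wp E Q) R).
Proof.
apply: (eqopX_ker (F := fun Z => 1%:M - dualS E (ext (tens Q R) Z))) ZE _ _.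
  exact: wp_ker.
have kK := wp_ker DE projQ; have [projK BK [T KE]] := kK.
set A := dualS E (ext Q U) in BK KE; set K := wp E Q in kK projK BK KE *.
rewrite -/U -/Z ext_tensQR dualS_mul_ext // dualS_ext // -/A.
apply: ker_projectorI; first exact: projector_tens.
  rewrite tens_ext // mulmxBl mul1mx comm -!mulmxA (mulmxA (ext A Z)).
  rewrite -ext_mul //.
  have -> : A *m K = K.
    by apply/esym/eqP; rewrite -subr_eq0 -{1}[K]mul1mx -mulmxBl BK.
  by rewrite !mulmxA -comm -mulmxA rr subrr.
move=> M; rewrite mulmxBl mul1mx => /eqP; rewrite subr_eq0 => /eqP ME.
(* A fixed point of A R, with A and R commuting and R idempotent, is fixed by R, hence also by A,
   hence by the kernel projector K of 1 - A. *)
have rM : ext R Z *m M = M.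
  by rewrite {1}ME comm !mulmxA rr -comm -ME.
have AM : ext A Z *m M = M by rewrite -{1}rM mulmxA -ME.
rewrite tens_ext // -mulmxA rM; apply/esym/eqP.
rewrite -subr_eq0 -{1}[M]mul1mx -mulmxBl -(ext1 UZ) -extB KE ext_mul //.
by rewrite -mulmxA extB ext1 // mulmxBl mul1mx AM subrr mulmx0.
Qed.

(** R passes through F, so the operator to be supported is S R with S = F(Q~); a factorization K = S
    B extends directly to one of K R through S R. *)
Lemma sp_tens : eqopX (sp E (tens Q R)) (tens (sp E Q) R).
Proof.
apply: (eqopX_supp (F := fun Z => extS E (ext (tens Q R) Z))) ZE _ _.
  exact: sp_supp.
have [projK KS [B KE]] := sp_supp DE projQ.
set S := extS E (ext Q U) in KS KE; set K := sp E Q in projK KS KE *.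
have SE : extS E (ext (tens Q R) Z) = ext R Z *m ext S Z.
  by rewrite ext_tensQR comm extS_mul_ext // extS_ext.
rewrite -/U -/Z SE; split; first exact: projector_tens.
  by rewrite tens_ext // -mulmxA (mulmxA (ext R Z)) rr mulmxA comm -mulmxA
    -ext_mul // KS.
by exists (ext B Z); rewrite tens_ext // comm -mulmxA -ext_mul // -KE.
Qed.

Lemma wlp_tens : leprojX (tens (wlp E Q) R) (wlp E (tens Q R)).
Proof.
apply: (leprojX_ker (F := fun Z => dualS E (1%:M - ext (tens Q R) Z)))
  (esym ZE) _ _; last exact: wlp_ker.
have [projK BK _] := wlp_ker DE projQ; set K := wlp E Q in projK BK *.
rewrite -/U -/Z ext_tensQR.
(* Failure of Q tensor R splits into failure of Q inside R and failure of R. On K tensor R the first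
   is annihilated because D(1 - Q~) K = 0, the second because (1 - R) R = 0. *)
have -> : 1%:M - ext (ext Q U) Z *m ext R Z =
    ext (1%:M - ext Q U) Z *m ext R Z + 1%:M *m ext (1%:M - R) Z.
  by rewrite mul1mx !extB !ext1 // mulmxBl mul1mx [RHS]addrC addrA subrK.
rewrite dualSD !dualS_mul_ext // dualS_ext // tens_ext // mulmxDl.
have rkr : ext R Z *m (ext K Z *m ext R Z) = ext K Z *m ext R Z.
  by rewrite comm mulmxA rr.
have rCkr : ext (1%:M - R) Z *m (ext K Z *m ext R Z) = 0.
  by rewrite comm mulmxA -ext_mul // mulmxBl mul1mx projR.1 subrr ext0 mul0mx.
by rewrite -!mulmxA rkr rCkr mulmx0 addr0 mulmxA -ext_mul // BK ext0 mul0mx.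
Qed.

End Tensor.

Local Open Scope fset_scope.

Theorem theorem4p10 (V : {fset nat}) (E : {linear Op V -> Op V})
  (W : {fset nat}) (P Q : Op W) :
  DProg E -> projector P -> projector Q ->
  (* (1) *)
  (wp E (0 : Op W) = 0 /\ sp E (0 : Op W) = 0 /\
   wlp E (1%:M : Op W) = 1%:M) /\
  (* (2) *)
  (leproj P Q ->
     (forall xp : Op W -> Op (V `|` W), xp = @wp V E W \/ xp = @wlp V E W ->
        leproj (xp P) (xp Q)) /\
     leproj (sp E P) (sp E Q)) /\
  (* (3) *)
  (forall xp : Op W -> Op (V `|` W), xp = @wp V E W \/ xp = @wlp V E W ->
     xp (pmeet P Q) = pmeet (xp P) (xp Q)) /\
  (* (4) *)
  leproj (sp E (pmeet P Q)) (pmeet (sp E P) (sp E Q)) /\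
  (* (5) *)
  (forall xp : Op W -> Op (V `|` W), xp = @wp V E W \/ xp = @wlp V E W ->
     leproj (pjoin (xp P) (xp Q)) (xp (pjoin P Q))) /\
  (* (6) *)
  pjoin (sp E P) (sp E Q) = sp E (pjoin P Q) /\
  (* (7) *)
  (forall (W' : {fset nat}) (R : Op W'), projector R ->
     [disjoint W' & V `|` W] ->
     eqopX (wp E (tens Q R)) (tens (wp E Q) R) /\
     eqopX (sp E (tens P R)) (tens (sp E P) R) /\
     leprojX (tens (wlp E Q) R) (wlp E (tens Q R))).
Proof.
move=> DE projP projQ.
split; first by split; [exact: wp0 | split; [exact: sp0 | exact: wlp1]].
split.
  move=> PQ; split=> [xp xpE|]; last exact: sp_mono.
  exact: (precondition_mono DE xpE).
split; first by move=> xp xpE; apply: (precondition_pmeet DE xpE).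
split; first exact: sp_pmeet.
split; first by move=> xp xpE; apply: (precondition_pjoin DE xpE).
split; first exact: sp_pjoin.
move=> W' R projR disj; split; first exact: wp_tens.
by split; [exact: sp_tens | exact: wlp_tens].
Qed.
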